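(* Let $f:X\to X$ be a continuous map of a compact metric space, and let $\{\mathcal G_k\}$ be a collection of grids for $X$, partially ordered by refinement. For each $k$, let $\mathcal F^{\mathcal G_k}:\mathcal G_k\rightrightarrows\mathcal G_k$ be the minimal multivalued map associated to $f$ on $\mathcal G_k$, and let $\mathfrak M^{\mathcal G_k}$ be the corresponding finest augmented Morse decomposition. Then for every $\mathcal G_{k_1}<\mathcal G_{k_2}$ there is an augmented Morse decomposition morphism $\mathfrak h_{\mathcal G_{k_1}}^{\mathcal G_{k_2}}:\mathfrak M^{\mathcal G_{k_1}}\to\mathfrak M^{\mathcal G_{k_2}}$ such that $\mathfrak h_{\mathcal G_{k_2}}^{\mathcal G_{k_3}}\circ\mathfrak h_{\mathcal G_{k_1}}^{\mathcal G_{k_2}}=\mathfrak h_{\mathcal G_{k_1}}^{\mathcal G_{k_3}}$ for any $\mathcal G_{k_1}<\mathcal G_{k_2}<\mathcal G_{k_3}$.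
   Context: A grid $\mathcal G$ on a compact metric space $X$ is a finite collection of nonempty compact subsets of $X$ such that (1) $X=\bigcup_{G\in\mathcal G}G$; (2) $G=\operatorname{cl}(\operatorname{int}(G))$ for all $G\in\mathcal G$; (3) $G\cap\operatorname{int}(H)=\emptyset$ for all $G\ne H$ in $\mathcal G$. For grids $\mathcal G,\mathcal G'$ on $X$, $\mathcal G$ refines $\mathcal G'$, written $\mathcal G<\mathcal G'$, if for every $G\in\mathcal G$ there is $G'\in\mathcal G'$ with $G\subset G'$. A multivalued map $\mathcal F:\mathcal G\rightrightarrows\mathcal G$ assigns to each $G\in\mathcal G$ a subset $\mathcal F(G)\subset\mathcal G$; it is identified with the directed graph on $\mathcal G$ with an edge $G\to H$ whenever $H\in\mathcal F(G)$. The minimal multivalued map associated to $f$ on $\mathcal G$ is $\mathcal F^{\mathcal G}(G):=\{H\in\mathcal G: H\cap f(G)\neq\emptyset\}$. An orbit of $\mathcal F$ is a sequence $\{G_i\}$ with $G_{i+1}\in\mathcal F(G_i)$. $G$ is recurrent if there is a nontrivial orbit (of length at least one) from $G$ to itself; recurrent $G,H$ are equivalent if there are orbits from $G$ to $H$ and from $H$ to $G$. The Morse sets $\mathcal S_j$ of the finest Morse decomposition of $\mathcal F$ are the equivalence classes, i.e. the nontrivial strongly connected components of the graph $\mathcal F$ (a single vertex with a loop counts as nontrivial), and the partial order is $\mathcal S_j\succeq\mathcal S_k$ iff there is an orbit from $\mathcal S_j$ to $\mathcal S_k$. (Vertices with no incoming or no outgoing edge may be removed from the graph; this does not affect the Morse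 sets or the order.) The finest augmented Morse decomposition is $\mathfrak M=(\{\mathcal S_j\},\succeq,\{\mathcal F_j:\mathcal S_j\rightrightarrows\mathcal S_j\})$, where $\mathcal F_j(G)=\mathcal F(G)\cap\mathcal S_j$. A grid map morphism between multivalued maps $\mathcal F$ and $\mathcal F'$ is a single-valued map $h$ between the underlying sets with $h(\mathcal F(G))\subset\mathcal F'(h(G))$ for all $G$. An augmented Morse decomposition morphism $\mathfrak h:\mathfrak M^{\mathcal G}\to\mathfrak M^{\mathcal G'}$ is a pair $(\bar h,\{h_j\})$, where $\bar h:\{\mathcal S_j^{\mathcal G}\}\to\{\mathcal S_j^{\mathcal G'}\}$ is a Morse decomposition morphism, i.e. $\bar h(\mathcal S^{\mathcal G}_j)\succeq^{\mathcal G'}\bar h(\mathcal S^{\mathcal G}_k)$ whenever $\mathcal S^{\mathcal G}_j\succeq^{\mathcal G}\mathcal S^{\mathcal G}_k$, and for each $j$, $h_j:\mathcal S_j^{\mathcal G}\to\bar h(\mathcal S_j^{\mathcal G})$ is a grid map morphism for the induced restriction maps on these Morse sets. Morphisms are composed componentwise: compose the maps $\bar h$, and for each Morse set compose $h_j$ with the component map on $\bar h(\mathcal S_j)$. *)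

(* Defs.v *)
From mathcomp Require Import all_boot all_order all_algebra.
From mathcomp Require Import all_classical all_reals.
From mathcomp Require Import topology metric_structure.

Set Implicit Arguments.
Unset Strict Implicit.
Unset Printing Implicit Defensive.

Local Open Scope classical_set_scope.

Record grid (X : topologicalType) := Grid {
  cells : set (set X);
  grid_finite : finite_set cells;
  grid_nonempty : forall G, cells G -> G !=set0;
  grid_compact : forall G, cells G -> compact G;
  grid_cover : \bigcup_(G in cells) G = [set: X];
  grid_regular : forall G, cells G -> G = closure (interior G);
  grid_disjoint : forall G H, cells G -> cells H -> G <> H ->
    G `&` interior H = set0 }.

(* Non-strict: every grid refines itself. *)
Definition refines (X : topologicalType) (g g' : grid X) : Prop :=
  forall G, cells g G -> exists2 G', cells g' G' & G `<=` G'.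

Definition mvmap (V : Type) := V -> set V.

(* Here and below, a set used as a type is the subtype of its elements: the
   vertices of [minimal_map f g] are the elements of the grid [g]. *)
Definition minimal_map (X : topologicalType) (f : X -> X) (g : grid X) :
    mvmap (cells g) :=
  fun G => [set H | (sval H `&` f @` sval G) !=set0].
Arguments minimal_map {X} f g : rename.

Section Recurrence.
Variables (V : Type) (F : mvmap V).

(* Only the terms [o 0, ..., o n] matter. *)
Definition orbit_of_length (n : nat) (G H : V) : Prop :=
  exists o : nat -> V,
    [/\ o 0%N = G, o n = H & forall i, (i < n)%N -> F (o i) (o i.+1)].

Definition has_orbit (G H : V) : Prop := exists n, orbit_of_length n G H.

Definition recurrent (G : V) : Prop :=
  exists2 n, (0 < n)%N & orbit_of_length n G G.

Definition recurrent_equiv (G H : V) : Prop := has_orbit G H /\ has_orbit H G.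

Definition morse_sets : set (set V) :=
  [set S | exists2 G, recurrent G &
     S = [set H | recurrent H /\ recurrent_equiv G H]].

Definition morse_ge (S T : morse_sets) : Prop :=
  exists G H, [/\ sval S G, sval T H & has_orbit G H].

Definition restr_map (S : set V) : mvmap S :=
  fun G => [set H | F (sval G) (sval H)].

Lemma has_orbit_refl G : has_orbit G G.
Proof. by exists 0%N, (fun=> G). Qed.

Lemma has_orbit_trans H G K : has_orbit G H -> has_orbit H K -> has_orbit G K.
Proof.
move=> [n [o [o0 on oF]]] [m [p [p0 pm pF]]]; exists (n + m)%N.
exists (fun i => if (i < n)%N then o i else p (i - n)%N); split.
- case: n on oF => [on _|//]; by rewrite p0 -on.
- by rewrite ltnNge leq_addr /= addKn.
- move=> i inm; case: (ltnP i n) => [i_n|n_i].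
    case: (ltnP i.+1 n) => [_|n_i1]; first exact: oF.
    have /eqP e : i.+1 == n by rewrite eqn_leq i_n n_i1.
    by rewrite e subnn p0 -on -e; exact: oF.
  rewrite ltnNge (leq_trans n_i (leqnSn i)) /= subSn //.
  by apply: pF; rewrite ltn_subLR.
Qed.

Lemma morse_set_connected (S : morse_sets) G H :
  sval S G -> sval S H -> has_orbit G H.
Proof.
case: S => S /= /set_mem [K _ ->] /= [_ [_ GK]] [_ [KH _]].
exact: has_orbit_trans KH.
Qed.

Lemma morse_set_closed (S : morse_sets) G H :
  sval S G -> recurrent H -> recurrent_equiv G H -> sval S H.
Proof.
case: S => S /= /set_mem [K _ ->] /= [_ [KG GK]] rH [GH HG].
split=> //; split; first exact: has_orbit_trans GH.
exact: has_orbit_trans GK.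
Qed.

Lemma morse_set_recurrent (S : morse_sets) G : sval S G -> recurrent G.
Proof. by case: S => S /= /set_mem [K _ ->] []. Qed.

Lemma morse_ge_refl S : morse_ge S S.
Proof.
case: S => S SF; have [G rG SE] := set_mem SF.
have SG : S G by rewrite SE; split=> //; split; exact: has_orbit_refl.
by exists G, G; split=> //; exact: has_orbit_refl.
Qed.

Lemma morse_ge_trans S T U : morse_ge S T -> morse_ge T U -> morse_ge S U.
Proof.
move=> [G [H [SG TH GH]]] [H' [K [TH' UK HK]]]; exists G, K; split=> //.
apply: (has_orbit_trans GH); apply: has_orbit_trans HK.
exact: morse_set_connected TH TH'.
Qed.

Lemma morse_ge_anti S T : morse_ge S T -> morse_ge T S -> S = T.
Proof.
move=> [G [H [SG TH GH]]] [H' [G' [TH' SG' HG']]].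
have HG : has_orbit H G.
  apply: has_orbit_trans (morse_set_connected SG' SG).
  exact: has_orbit_trans (morse_set_connected TH TH') HG'.
apply: val_inj; apply/seteqP; split=> K /= => [SK|TK].
- apply: (morse_set_closed TH (morse_set_recurrent SK)); split.
    exact: has_orbit_trans HG (morse_set_connected SG SK).
  exact: has_orbit_trans (morse_set_connected SK SG) GH.
- apply: (morse_set_closed SG (morse_set_recurrent TK)); split.
    exact: has_orbit_trans GH (morse_set_connected TH TK).
  exact: has_orbit_trans (morse_set_connected TK TH) HG.
Qed.

End Recurrence.

(* Of a general Morse decomposition only the data are recorded, with the order
   axioms; this is all that morphisms refer to. *)
Record aug_morse (V : Type) := AugMorse {
  amd_sets : set (set V);
  amd_ge : amd_sets -> amd_sets -> Prop;
  amd_ge_refl : forall S, amd_ge S S;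
  amd_ge_anti : forall S T, amd_ge S T -> amd_ge T S -> S = T;
  amd_ge_trans : forall S T U, amd_ge S T -> amd_ge T U -> amd_ge S U;
  amd_map : forall S : amd_sets, mvmap (sval S) }.

Definition finest_aug_morse (V : Type) (F : mvmap V) : aug_morse V :=
  @AugMorse V (morse_sets F) (@morse_ge V F) (@morse_ge_refl V F)
    (@morse_ge_anti V F) (@morse_ge_trans V F)
    (fun S => @restr_map V F (sval S)).

Definition grid_map_morphism (V V' : Type) (F : mvmap V) (F' : mvmap V')
    (h : V -> V') : Prop :=
  forall G, h @` F G `<=` F' (h G).

Record amd_morphism (V V' : Type) (M : aug_morse V) (M' : aug_morse V') :=
  AmdMorphism {
    amd_bar : amd_sets M -> amd_sets M';
    amd_bar_homo : forall S T, amd_ge S T -> amd_ge (amd_bar S) (amd_bar T);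
    amd_comp : forall S : amd_sets M, sval S -> sval (amd_bar S);
    amd_compP : forall S : amd_sets M,
      grid_map_morphism (@amd_map _ M S) (@amd_map _ M' (amd_bar S))
        (@amd_comp S) }.

Section Composition.
Variables (V1 V2 V3 : Type).
Variables (M1 : aug_morse V1) (M2 : aug_morse V2) (M3 : aug_morse V3).
Variables (h' : amd_morphism M2 M3) (h : amd_morphism M1 M2).

Definition compose_bar (S : amd_sets M1) : amd_sets M3 :=
  amd_bar h' (amd_bar h S).

Definition compose_comp (S : amd_sets M1) (G : sval S) :
    sval (compose_bar S) :=
  amd_comp h' (amd_comp h G).

Lemma compose_bar_homo S T :
  amd_ge S T -> amd_ge (compose_bar S) (compose_bar T).
Proof. by move=> ST; do 2 apply: amd_bar_homo. Qed.

Lemma compose_compP (S : amd_sets M1) :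
  grid_map_morphism (@amd_map _ M1 S) (@amd_map _ M3 (compose_bar S))
    (@compose_comp S).
Proof.
move=> G _ [H GH <-]; apply: amd_compP.
by exists (amd_comp h H) => //; apply: amd_compP; exists H.
Qed.

Definition amd_compose : amd_morphism M1 M3 :=
  AmdMorphism compose_bar_homo compose_compP.

End Composition.

(* Main.v *)
Require Import Defs.
From mathcomp Require Import all_boot all_order all_algebra.
From mathcomp Require Import all_classical all_reals.
From mathcomp Require Import topology metric_structure.

(** Since [G = cl (int G)] is nonempty, a cell [G] of a grid lies in at most one
cell of a coarser grid, so a refinement determines a map of cells, and these
maps compose. Such a map is a morphism of the minimal multivalued maps. A
morphism of multivalued maps sends orbits to orbits, hence strongly connected
components into strongly connected components; as a morphism of Morse
decompositions is determined by its values on vertices, this is functorial. *)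

Local Open Scope classical_set_scope.

Section InducedMorphism.
Variables (V V' : Type) (F : mvmap V) (F' : mvmap V') (h : V -> V').
Hypothesis hP : grid_map_morphism F F' h.

Lemma orbit_of_length_image n G H :
  orbit_of_length F n G H -> orbit_of_length F' n (h G) (h H).
Proof.
move=> [o [o0 on oF]]; exists (h \o o); split=> [||i i_n] /=.
- by rewrite o0.
- by rewrite on.
- by apply: hP; exists (o i.+1) => //; exact: oF.
Qed.

Lemma has_orbit_image G H : has_orbit F G H -> has_orbit F' (h G) (h H).
Proof. by move=> [n GH]; exists n; exact: orbit_of_length_image. Qed.

Lemma recurrent_image G : recurrent F G -> recurrent F' (h G).
Proof. by move=> [n n0 GG]; exists n => //; exact: orbit_of_length_image. Qed.

(** Ranging over all [G] in [S] avoids choosing a representative; when [S] is a Morse set, every [G]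
    contributes the same class. *)
Definition induced_set (S : set V) : set V' :=
  [set H | recurrent F' H /\ exists2 G, S G & recurrent_equiv F' (h G) H].

Lemma induced_set_morse (S : morse_sets F) :
  induced_set (sval S) \in morse_sets F'.
Proof.
(* Reflexivity of the order supplies a vertex of [S]. *)
have [G [_ [SG _ _]]] := morse_ge_refl S.
apply/mem_set; exists (h G).
  exact/recurrent_image/(morse_set_recurrent SG).
(* Orbits both ways between [G] and [K] map to orbits between [h G] and [h K], so the class of [h K]
   is that of [h G]. *)
apply/seteqP; split=> [H [rH [K SK [KH HK]]]|H [rH GH]]; split=> //.
- split.
  + by apply: has_orbit_trans KH; exact/has_orbit_image/(morse_set_connected SG).
  + by apply: (has_orbit_trans HK); exact/has_orbit_image/(morse_set_connected SK).
- by exists G.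
Qed.

Definition induced_bar (S : morse_sets F) : morse_sets F' :=
  exist _ (induced_set (sval S)) (induced_set_morse S).

Lemma induced_bar_image (S : morse_sets F) G :
  sval S G -> sval (induced_bar S) (h G).
Proof.
move=> SG; split; first exact/recurrent_image/(morse_set_recurrent SG).
by exists G => //; split; exact: has_orbit_refl.
Qed.

Lemma induced_bar_homo S T :
  morse_ge S T -> morse_ge (induced_bar S) (induced_bar T).
Proof.
move=> [G [H [SG TH GH]]]; exists (h G), (h H).
split; [exact: induced_bar_image|exact: induced_bar_image|].
exact: has_orbit_image.
Qed.

Definition induced_comp (S : morse_sets F) (G : sval S) :
    sval (induced_bar S) :=
  exist _ (h (sval G)) (mem_set (induced_bar_image S _ (set_mem (svalP G)))).

Lemma induced_compP (S : morse_sets F) :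
  grid_map_morphism (restr_map F (S := sval S))
    (restr_map F' (S := sval (induced_bar S))) (@induced_comp S).
Proof. by move=> G _ [H GH <-]; apply: hP; exists (sval H). Qed.

Definition induced_morphism :
    amd_morphism (finest_aug_morse F) (finest_aug_morse F') :=
  @AmdMorphism _ _ (finest_aug_morse F) (finest_aug_morse F')
    induced_bar induced_bar_homo induced_comp induced_compP.

End InducedMorphism.

(** Orbits of length zero at the common vertex give both inequalities, and the order is
    antisymmetric. *)
Lemma morse_sets_eq (V : Type) (F : mvmap V) (S T : morse_sets F) G :
  sval S G -> sval T G -> S = T.
Proof.
by move=> SG TG; apply: morse_ge_anti; exists G, G; split=> //;
  exact: has_orbit_refl.
Qed.

(** The components of [h] and [h'] may a priori have different codomains, so only underlying
    vertices are compared. Since Morse sets are nonempty and pairwise disjoint, these already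
    determine [amd_bar]. *)
Lemma amd_morphism_ext (V V' : Type) (F : mvmap V) (F' : mvmap V')
    (h h' : amd_morphism (finest_aug_morse F) (finest_aug_morse F')) :
  (forall (S : morse_sets F) (G : sval S),
     sval (amd_comp h G) = sval (amd_comp h' G)) -> h = h'.
Proof.
case: h h' => b bP c cP [b' bP' c' cP'] /= hh'.
have bb' : b = b'.
  apply/funext => S; have [G [_ [SG _ _]]] := morse_ge_refl S.
  pose G' : sval S := exist _ G (mem_set SG).
  apply: (@morse_sets_eq _ _ _ _ (sval (c S G'))).
    exact: set_mem (svalP (c S G')).
  by rewrite hh'; exact: set_mem (svalP (c' S G')).
(* The type of [c'] depends on [b'], so [b'] is replaced by [b] before [c = c'] can be stated. *)
case: _ / bb' bP' c' cP' hh' => bP' c' cP' hh'.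
have cc' : c = c'.
  apply: functional_extensionality_dep => S; apply/funext => G.
  exact/val_inj/hh'.
case: _ / cc' cP' {hh'} => cP'.
by rewrite (Prop_irrelevance bP bP') (Prop_irrelevance cP cP').
Qed.

Section Refinement.
Variables (X : topologicalType).

Lemma cell_interior_nonempty (g : grid X) G : cells g G -> interior G !=set0.
Proof.
move=> gG; apply/set0P/eqP => G0; have [x] := grid_nonempty gG.
by rewrite (grid_regular gG) G0 closure0.
Qed.

(** An interior point of [G] lies in [H] and in the interior of [H'], which is impossible for
    distinct cells of [g']. *)
Lemma coarser_cell_unique (g g' : grid X) G H H' :
  cells g G -> cells g' H -> cells g' H' -> G `<=` H -> G `<=` H' -> H = H'.
Proof.
move=> gG gH gH' GH GH'; apply: contrapT => HH'.
have [x Gx] := cell_interior_nonempty _ _ gG.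
suff : (H `&` interior H') x by rewrite (grid_disjoint gH gH' HH').
split; first by apply: GH; exact: interior_subset Gx.
exact: (interiorS GH') Gx.
Qed.

Lemma coarser_cell_exists (g g' : grid X) : refines g g' ->
  forall G : cells g, exists H : cells g', sval G `<=` sval H.
Proof.
move=> gg' [G gG] /=; have [H gH GH] := gg' _ (set_mem gG).
by exists (exist _ H (mem_set gH)).
Qed.

(** By [coarser_cell_unique], the value depends neither on the choice made by [cid] nor on the proof
    [r]. *)
Definition coarser_cell (g g' : grid X) (r : refines g g') (G : cells g) :
  cells g' := sval (cid (coarser_cell_exists g g' r G)).

Lemma sub_coarser_cell (g g' : grid X) (r : refines g g') G :
  sval G `<=` sval (coarser_cell g g' r G).
Proof. exact: svalP (cid (coarser_cell_exists g g' r G)). Qed.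

Lemma coarser_cell_morphism (f : X -> X) (g g' : grid X) (r : refines g g') :
  grid_map_morphism (minimal_map f g) (minimal_map f g') (coarser_cell g g' r).
Proof.
(* The same point [y = f x] serves as witness, both cells having only grown. *)
move=> G _ [H [y [Hy [x Gx fxy]]] <-]; exists y; split.
  exact: sub_coarser_cell.
by exists x => //; exact: sub_coarser_cell.
Qed.

(** Both sides are cells of [g3] containing [G]. *)
Lemma coarser_cell_comp (g1 g2 g3 : grid X) (r12 : refines g1 g2)
    (r23 : refines g2 g3) (r13 : refines g1 g3) G :
  coarser_cell g2 g3 r23 (coarser_cell g1 g2 r12 G) = coarser_cell g1 g3 r13 G.
Proof.
apply: val_inj; apply: (coarser_cell_unique g1 g3 (sval G)).
- exact: set_mem (svalP G).
- exact: set_mem (svalP (coarser_cell _ _ _ _)).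
- exact: set_mem (svalP (coarser_cell _ _ _ _)).
- apply: subset_trans (sub_coarser_cell _ _ r12 _) _; exact: sub_coarser_cell.
- exact: sub_coarser_cell.
Qed.

End Refinement.

Theorem theorem4p6 (R : realType) (X : metricType R)
    (compactX : compact [set: X]) (f : X -> X) (cf : continuous f)
    (K : Type) (g : K -> grid X) :
  exists h : forall k1 k2 : K, refines (g k1) (g k2) ->
      amd_morphism (finest_aug_morse (minimal_map f (g k1)))
                   (finest_aug_morse (minimal_map f (g k2))),
  forall (k1 k2 k3 : K) (r12 : refines (g k1) (g k2))
      (r23 : refines (g k2) (g k3)) (r13 : refines (g k1) (g k3)),
    amd_compose (h k2 k3 r23) (h k1 k2 r12) = h k1 k3 r13.
Proof.
exists (fun k1 k2 r => induced_morphism _ _ _ _ _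
  (coarser_cell_morphism _ f (g k1) (g k2) r)).
move=> k1 k2 k3 r12 r23 r13; apply: amd_morphism_ext => S G /=.
exact: coarser_cell_comp.
Qed.
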